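(* Let $A\in\mathbb{R}^{N\times N}$ be a Metzler matrix with $\mathbf 1=(1,\dots,1)^T\in\ker(A^T)$, and let $\alpha,\beta\in\mathbb{R}$ satisfy $0\le\alpha\le1$, $\beta>0$, $\alpha\beta+\frac1{2\beta}\le1$. Let the unique steady state $y^*$ of the initial value problem $y'=Ay$, $y(0)=y^0>0$, be positive. Then the iterates of the SSPMPRK2($\alpha,\beta$) scheme applied to $y'=Ay$ locally converge towards $y^*$ for all $\Delta t>0$, if any of the following conditions holds: (a) $\alpha<\frac1{2\beta}$ and $(\alpha,\beta)\ne(0,\frac12)$; (b) $\alpha=\frac1{2\beta}$ or $(\alpha,\beta)=(0,\frac12)$, and additionally all nonzero eigenvalues of $A$ have negative real part. Here local convergence means: for every $\Delta t>0$ there exists $\delta>0$ such that for every starting vector $y^0\in\mathbb{R}^N_{>0}$ with $n^Ty^0=n^Ty^*$ for all $n\in\ker(A^T)$ and $\|y^0-y^*\|<\delta$, the iterates $y^{n+1}=g(y^n)$ satisfy $y^n\to y^*$ as $n\to\infty$.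
   Context: $\mathbb{R}^N_{>0}$ is the set of vectors with all components positive. A Metzler matrix is a real square matrix with nonnegative off-diagonal entries. For $y\in\mathbb{R}^N_{>0}$ and $x\in\mathbb{R}$, $\operatorname{diag}(y)^x$ is the diagonal matrix with entries $y_i^x$. The steady state of the initial value problem $y'=Ay$, $y(0)=y^0$, is the unique $y^*\in\ker(A)$ with $n^Ty^*=n^Ty^0$ for all $n\in\ker(A^T)$ (i.e. having the same linear invariants as $y^0$). The scheme SSPMPRK2($\alpha,\beta$) applied to $y'=Ay$ with step size $\Delta t>0$ is the map $g:\mathbb{R}^N_{>0}\to\mathbb{R}^N_{>0}$, $y^n\mapsto y^{n+1}$, where $y^{(1)},y^{n+1}\in\mathbb{R}^N_{>0}$ are the unique solutions of the successive linear systems $$y^{(1)}=y^n+\beta\Delta t\,A\,y^{(1)},$$ $$y^{n+1}=(1-\alpha)y^n+\alpha y^{(1)}+\Delta t\,A\operatorname{diag}(y^{n+1})\operatorname{diag}(y^{(1)})^{-s}\operatorname{diag}(y^n)^{s-1}\bigl(\beta_{20}y^n+\beta_{21}y^{(1)}\bigr),$$ with $\beta_{20}=1-\frac1{2\beta}-\alpha\beta$, $\beta_{21}=\frac1{2\beta}$, $s=\frac{1-\alpha\beta+\alpha\beta^2}{\beta(1-\alpha\beta)}$. *)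

(* Defs.v *)
From mathcomp Require Import all_boot all_order all_algebra.
From mathcomp Require Import all_classical all_reals all_analysis.
From mathcomp Require Import complex.
From mathcomp Require Import ring lra.

Set Implicit Arguments.
Unset Strict Implicit.
Unset Printing Implicit Defensive.

Import Order.TTheory GRing.Theory Num.Theory.
Import numFieldNormedType.Exports.

Local Open Scope classical_set_scope.
Local Open Scope ring_scope.

Definition metzler (R : realType) (N : nat) (A : 'M[R]_N) : Prop :=
  forall i j : 'I_N, i != j -> 0 <= A i j.

Definition pos_vec (R : realType) (N : nat) (y : 'cV[R]_N) : Prop :=
  forall i : 'I_N, 0 < y i 0.

Definition same_invariants (R : realType) (N : nat) (A : 'M[R]_N)
    (y z : 'cV[R]_N) : Prop :=
  forall n : 'cV[R]_N, A^T *m n = 0 -> n^T *m y = n^T *m z.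

Definition steady_state (R : realType) (N : nat) (A : 'M[R]_N)
    (y0 ystar : 'cV[R]_N) : Prop :=
  unique (fun z : 'cV[R]_N => A *m z = 0 /\ same_invariants A z y0) ystar.

Definition diagv (R : realType) (N : nat) (y : 'cV[R]_N) : 'M[R]_N :=
  diag_mx y^T.

Definition diag_pow (R : realType) (N : nat) (y : 'cV[R]_N) (x : R) : 'M[R]_N :=
  diag_mx (\row_i (y i 0 `^ x)).

Section Scheme.
Variables (R : realType) (N : nat) (A : 'M[R]_N) (alpha beta dt : R).

Definition beta20 : R := 1 - 1 / (2 * beta) - alpha * beta.

Definition beta21 : R := 1 / (2 * beta).

Definition sspmprk_s : R :=
  (1 - alpha * beta + alpha * beta ^+ 2) / (beta * (1 - alpha * beta)).

Definition sspmprk2_stage1 (y y1 : 'cV[R]_N) : Prop :=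
  y1 = y + (beta * dt) *: (A *m y1).

Definition sspmprk2_stage2 (y y1 x : 'cV[R]_N) : Prop :=
  x = (1 - alpha) *: y + alpha *: y1
      + dt *: (A *m diagv x *m diag_pow y1 (- sspmprk_s)
               *m diag_pow y (sspmprk_s - 1)
               *m (beta20 *: y + beta21 *: y1)).

Definition sspmprk2_rel (y x : 'cV[R]_N) : Prop :=
  exists y1 : 'cV[R]_N,
    [/\ pos_vec y1, pos_vec x, sspmprk2_stage1 y y1 & sspmprk2_stage2 y y1 x].

(* The generating map; the value 0 is only taken where the two systems have no
   positive solutions, which [sspmprk2_relP] below rules out for y > 0. *)
Definition sspmprk2 (y : 'cV[R]_N) : 'cV[R]_N := xget 0 [set x | sspmprk2_rel y x].

End Scheme.

Definition nonzero_eigenvalues_neg (R : realType) (N : nat) (A : 'M[R]_N) : Prop :=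
  forall z : R[i],
    eigenvalue (map_mx (real_complex R) A) z -> z != 0 -> complex.Re z < 0.

Section WellDefined.
Variables (R : realType) (N : nat).
Implicit Types (A B : 'M[R]_N) (b x y w : 'cV[R]_N).

Lemma colsum0 A : A^T *m const_mx 1 = 0 :> 'cV[R]_N -> forall j, \sum_i A i j = 0.
Proof.
move=> /matrixP h j; have := h j 0; rewrite !mxE; apply: etrans.
by apply: eq_bigr => i _; rewrite !mxE mulr1.
Qed.

Lemma metzler_sol_ge0 B b x : metzler B -> (forall j, \sum_i B i j = 0) ->
  (forall i, 0 <= b i 0) -> x = b + B *m x -> forall i, 0 <= x i 0.
Proof.
move=> mB cB b0 ex.
have S0 : 0 <= \sum_(i | x i 0 < 0) x i 0.
  have -> : \sum_(i | x i 0 < 0) x i 0 =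
      \sum_(i | x i 0 < 0) b i 0 +
      \sum_j (\sum_(i | x i 0 < 0) B i j) * x j 0.
    under [X in _ + X]eq_bigr do rewrite mulr_suml.
    rewrite exchange_big -big_split /=; apply: eq_bigr => i _.
    by rewrite {1}ex !mxE.
  apply: addr_ge0; first by apply: sumr_ge0.
  apply: sumr_ge0 => j _; have [xj|xj] := ltP (x j 0) 0.
    apply: mulr_le0 (ltW xj); have := cB j.
    rewrite (bigID (fun i => x i 0 < 0)) /= => /eqP.
    rewrite addr_eq0 => /eqP ->; rewrite oppr_le0.
    apply: sumr_ge0 => i xi; apply: mB; apply: contraNneq xi => -> //.
  apply: mulr_ge0 => //; apply: sumr_ge0 => i xi; apply: mB.
  by apply: contraTneq xi => ->; rewrite -leNgt.
move=> i; rewrite leNgt; apply/negP => xi.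
move: S0; rewrite leNgt => /negP; apply.
rewrite (bigD1 i) //=; apply: ltr_wnDr => //.
by apply: sumr_le0 => j /andP[/ltW].
Qed.

Lemma metzler_sol_gt0 B b x : metzler B -> (forall j, \sum_i B i j = 0) ->
  pos_vec b -> x = b + B *m x -> pos_vec x.
Proof.
move=> mB cB b0 ex; have x0 := metzler_sol_ge0 mB cB (fun i => ltW (b0 i)) ex.
move=> i; rewrite lt_def x0 andbT; apply/eqP => xi0.
have : 0 < (b + B *m x) i 0.
  rewrite !mxE; apply: ltr_wpDr => //; apply: sumr_ge0 => j _.
  have [<-|nij] := eqVneq i j; first by rewrite xi0 mulr0.
  by rewrite mulr_ge0 ?mB.
by rewrite -ex xi0 ltxx.
Qed.

Lemma metzler_sol_exists B b : metzler B -> (forall j, \sum_i B i j = 0) ->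
  exists x, x = b + B *m x /\ forall x', x' = b + B *m x' -> x' = x.
Proof.
move=> mB cB.
have inj (x : 'cV_N) : (1%:M - B) *m x = 0 -> x = 0.
  rewrite mulmxBl mul1mx => /eqP; rewrite subr_eq0 => /eqP ex.
  have h (z : 'cV_N) : z = B *m z -> forall i, 0 <= z i 0.
    move=> ez; apply: (@metzler_sol_ge0 B 0 z) => //; last by rewrite add0r.
    by move=> i; rewrite mxE.
  apply/matrixP => i j; rewrite ord1 mxE; apply/eqP.
  rewrite eq_le h // andbT -oppr_ge0.
  by have := h (- x); rewrite mulmxN -ex => /(_ erefl i); rewrite mxE.
have u : 1%:M - B \in unitmx.
  rewrite -unitmx_tr -row_free_unit; apply: inj_row_free => v hv.
  by apply: trmx_inj; rewrite trmx0; apply: inj; rewrite -[LHS]trmxK trmx_mul trmxK hv trmx0.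
have eqv (x : 'cV_N) : x = b + B *m x <-> (1%:M - B) *m x = b.
  rewrite mulmxBl mul1mx; split => [{1}->|<-]; first by rewrite addrK.
  by rewrite subrK.
exists (invmx (1%:M - B) *m b); split; first by apply/eqv; rewrite mulKVmx.
by move=> x' /eqv <-; rewrite mulKmx.
Qed.

Lemma metzler_diag A (d : 'rV[R]_N) : metzler A -> (forall j, \sum_i A i j = 0) ->
  (forall i, 0 <= d 0 i) ->
  metzler (A *m diag_mx d) /\ (forall j, \sum_i (A *m diag_mx d) i j = 0).
Proof.
move=> mA cA d0; split => [i j nij|j].
  by rewrite mul_mx_diag mxE mulr_ge0 ?mA.
under eq_bigr do rewrite mul_mx_diag mxE.
by rewrite -mulr_suml cA mul0r.
Qed.

Lemma sspmprk2_relP A (alpha beta dt : R) y :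
  metzler A -> A^T *m const_mx 1 = 0 :> 'cV[R]_N ->
  0 <= alpha <= 1 -> 0 < beta -> alpha * beta + 1 / (2 * beta) <= 1 ->
  0 < dt -> pos_vec y ->
  (exists! y1, sspmprk2_stage1 A beta dt y y1) /\
  (forall y1, sspmprk2_stage1 A beta dt y y1 ->
     pos_vec y1 /\
     exists! x, sspmprk2_stage2 A alpha beta dt y y1 x) /\
  sspmprk2_rel A alpha beta dt y (sspmprk2 A alpha beta dt y).
Proof.
move=> mA /colsum0 cA /andP[a0 a1] b0 ab dt0 y0.
have E1 : (A *m diag_mx (const_mx (beta * dt))) = (beta * dt) *: A.
  by apply/matrixP => i j; rewrite mul_mx_diag !mxE mulrC.
have [m1 c1] : metzler ((beta * dt) *: A) /\ forall j, \sum_i ((beta * dt) *: A) i j = 0.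
  rewrite -E1; apply: metzler_diag => // i; rewrite mxE.
  by rewrite mulr_ge0 ?ltW.
have st1 z : sspmprk2_stage1 A beta dt y z <-> z = y + ((beta * dt) *: A) *m z.
  by rewrite /sspmprk2_stage1 -scalemxAl.
have [y1 [ey1 uy1]] := metzler_sol_exists y m1 c1.
have S2 z : sspmprk2_stage1 A beta dt y z -> pos_vec z /\
    exists x, [/\ pos_vec x, sspmprk2_stage2 A alpha beta dt y z x &
      forall x', sspmprk2_stage2 A alpha beta dt y z x' -> x' = x].
  move=> /st1 ez; have z0 := metzler_sol_gt0 m1 c1 y0 ez; split=> //.
  pose d : 'rV[R]_N := \row_i (dt * (z i 0 `^ (- sspmprk_s alpha beta) *
     (y i 0 `^ (sspmprk_s alpha beta - 1) *
     (beta20 alpha beta * y i 0 + beta21 beta * z i 0)))).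
  have [m2 c2] : metzler (A *m diag_mx d) /\ forall j, \sum_i (A *m diag_mx d) i j = 0.
    apply: metzler_diag => // i; rewrite mxE.
    have b21 : 0 <= beta21 beta by rewrite /beta21 divr_ge0 // mulr_ge0 // ltW.
    have b20 : 0 <= beta20 alpha beta by rewrite /beta20; lra.
    apply: mulr_ge0; first exact: ltW.
    do 2 (apply: mulr_ge0; first exact: powR_ge0).
    by apply: addr_ge0; apply: mulr_ge0 => //; apply: ltW.
  pose c : 'cV[R]_N := (1 - alpha) *: y + alpha *: z.
  have st2 x : sspmprk2_stage2 A alpha beta dt y z x <-> x = c + (A *m diag_mx d) *m x.
    rewrite /sspmprk2_stage2 -/c.
    suff -> : dt *: (A *m diagv x *m diag_pow z (- sspmprk_s alpha beta)
       *m diag_pow y (sspmprk_s alpha beta - 1)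
       *m (beta20 alpha beta *: y + beta21 beta *: z)) = A *m diag_mx d *m x by [].
    rewrite -!mulmxA scalemxAr; congr (_ *m _).
    by apply/matrixP => i j; rewrite /diagv /diag_pow [j]ord1 !mul_diag_mx !mxE; ring.
  have c0 : pos_vec c.
    move=> i; rewrite !mxE; have := y0 i; have := z0 i => zi yi.
    by have [->|/eqP an0] := eqVneq alpha 0; [rewrite subr0 mul1r mul0r addr0 | nra].
  have [x [ex ux]] := metzler_sol_exists c m2 c2.
  exists x; split; [exact: metzler_sol_gt0 ex | exact/st2 | by move=> x' /st2/ux].
split; first by exists y1; split; [exact/st1 | by move=> z /st1/uy1].
split.
  move=> z /S2[z0 [x [x0 ex ux]]]; split=> //.
  by exists x; split => // x' /ux.
have /S2[y10 [x [x0 ex ux]]] := (st1 y1).2 ey1.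
rewrite /sspmprk2; case: xgetP => [x' -> //|/(_ x)]; case.
by exists y1; split => //; apply/st1.
Qed.

End WellDefined.

(* Main.v *)
(* Let Z = dt A, w = ystar, <u,v> = sum_i u_i v_i / w_i. As Z has zero column
   sums and Z w = 0, -2 <u, Z u> = sum_ij Z_ij w_j (u_i/w_i - u_j/w_j)^2 >= 0,
   with equality only on ker Z. The derivative of the scheme at ystar is
   R(Z) = P(Z)/Q(Z), and with gam = 1/2 + (1-alpha) beta,
   sig = (2 beta - 1)(1 - 2 alpha beta)/2 >= 0 and f = v - gam Z v,
   |Q v|^2 - |P v|^2
     = gam sig |Z^2 v|^2 - 2 <f, Z f> - sig <Z v, Z^2 v> >= -2 <f, Z f>.
   Uniqueness of the steady state makes Z injective on its range, so R(Z) is a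
   strict contraction there, and no spectral theory is needed. The weights of
   the second stage depend on y and y1 only through the ratios y1_i / y_i, so
   the remainder is controlled by the expansion of a one-variable function
   at 1. *)
Require Import Defs.
From mathcomp Require Import all_boot all_order all_algebra.
From mathcomp Require Import all_classical all_reals all_analysis.
From mathcomp Require Import complex.
From mathcomp Require Import ring lra.

Import Order.TTheory GRing.Theory Num.Theory.
Import numFieldNormedType.Exports.

Local Open Scope classical_set_scope.
Local Open Scope ring_scope.

Set Implicit Arguments.
Unset Strict Implicit.
Unset Printing Implicit Defensive.

Lemma sqr_sum_le (R : realFieldType) (N : nat) (a : 'I_N -> R) :
  (\sum_i a i) ^+ 2 <= N%:R * \sum_i a i ^+ 2.
Proof.
have E : \sum_i \sum_j (a i ^+ 2 + a j ^+ 2) = 2 * (N%:R * \sum_i a i ^+ 2).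
  under eq_bigr do rewrite big_split /= sumr_const card_ord.
  by rewrite big_split /= sumr_const card_ord sumrMnl -mulr_natl; ring.
rewrite -(ler_pM2l (ltr0n R 2)) -E expr2 mulr_suml mulr_sumr.
apply: ler_sum => i _; rewrite mulr_sumr mulr_sumr; apply: ler_sum => j _.
by rewrite -subr_ge0; have := sqr_ge0 (a i - a j); lra.
Qed.

(** * The quadratic form weighted by [1 / w] *)

Section WeightedForm.
Variables (R : realType) (N : nat) (w : 'cV[R]_N).
Hypothesis w_gt0 : pos_vec w.
Implicit Types (A M : 'M[R]_N) (u v f : 'cV[R]_N).

Let w_ge0 i : 0 <= w i 0. Proof. exact/ltW/w_gt0. Qed.

Definition wdot u v : R := \sum_i u i 0 * v i 0 / w i 0.

Definition wsq u : R := wdot u u.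

Lemma wsqE u : wsq u = \sum_i u i 0 ^+ 2 / w i 0.
Proof. by apply: eq_bigr => i _; rewrite expr2. Qed.

Lemma wsq_ge0 u : 0 <= wsq u.
Proof.
by rewrite wsqE; apply: sumr_ge0 => i _; rewrite divr_ge0 ?sqr_ge0 ?w_ge0.
Qed.

Lemma wsq_le u v c : (forall i, u i 0 ^+ 2 <= c * v i 0 ^+ 2) ->
  wsq u <= c * wsq v.
Proof.
move=> h; rewrite !wsqE mulr_sumr; apply: ler_sum => i _.
by rewrite mulrA ler_pM2r ?h // invr_gt0.
Qed.

Lemma sqr_coord_le_wsq u i : u i 0 ^+ 2 <= w i 0 * wsq u.
Proof.
rewrite -ler_pdivrMl // mulrC wsqE (bigD1 i) //= lerDl.
by apply: sumr_ge0 => j _; rewrite divr_ge0 ?sqr_ge0 ?w_ge0.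
Qed.

Lemma wsqN u : wsq (- u) = wsq u.
Proof. by rewrite !wsqE; apply: eq_bigr => i _; rewrite mxE sqrrN. Qed.

(** Young's inequality with a free parameter, the gap being a square in each coordinate. The final
    estimate takes [c = kap], where [(1 + kap) * (1 - kap) < 1]. *)
Lemma wsqD_le u v c : 0 < c ->
  wsq (u + v) <= (1 + c) * wsq u + (1 + c^-1) * wsq v.
Proof.
move=> c0; rewrite !wsqE !mulr_sumr -big_split /=; apply: ler_sum => i _.
rewrite !(mulrA _ _ _^-1) -mulrDl ler_pM2r ?invr_gt0 // mxE -subr_ge0.
have -> : (1 + c) * u i 0 ^+ 2 + (1 + c^-1) * v i 0 ^+ 2 - (u i 0 + v i 0) ^+ 2
  = c^-1 * (c * u i 0 - v i 0) ^+ 2 by field; rewrite gt_eqF.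
by rewrite mulr_ge0 ?sqr_ge0 // invr_ge0 ltW.
Qed.

Lemma wsqD_le2 u v : wsq (u + v) <= 2 * wsq u + 2 * wsq v.
Proof. by have := @wsqD_le u v 1 ltr01; rewrite invr1. Qed.

Lemma wsq_mulmx_le M : exists2 C, 0 < C & forall u, wsq (M *m u) <= C * wsq u.
Proof.
pose S := \sum_i \sum_j M i j ^+ 2 * w j 0 / w i 0.
have S0 : 0 <= S.
  by apply: sumr_ge0 => i _; apply: sumr_ge0 => j _; rewrite divr_ge0 // mulr_ge0 ?sqr_ge0.
exists (1 + N%:R * S) => [|u]; first by rewrite ltr_pwDl // mulr_ge0.
apply: (@le_trans _ _ (N%:R * S * wsq u)); last first.
  by rewrite ler_wpM2r ?wsq_ge0 // lerDr.
rewrite {1}wsqE -mulrA /S mulr_suml mulr_sumr; apply: ler_sum => i _.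
rewrite -ler_pdivlMr ?invr_gt0 // invrK mxE; apply: le_trans (sqr_sum_le _) _.
rewrite -mulrA ler_wpM2l // mulr_suml mulr_suml; apply: ler_sum => j _.
rewrite exprMn (_ : _ / _ * _ * _ = M i j ^+ 2 * (w j 0 * wsq u)).
  by rewrite ler_wpM2l ?sqr_ge0 // sqr_coord_le_wsq.
by field; rewrite gt_eqF.
Qed.

(** * Dissipativity with respect to the weighted form *)

Section Dissipative.
Variable Z : 'M[R]_N.
Hypotheses (Zm : metzler Z) (Zcol : forall j, \sum_i Z i j = 0) (Zw : Z *m w = 0).

Let Zrow i : \sum_j Z i j * w j 0 = 0.
Proof. by move/matrixP/(_ i 0): Zw; rewrite !mxE. Qed.

(** On expanding the square, the two pure terms carry the row sums of [Z_ij w_j] and the column sums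
    of [Z], both zero; only the cross term survives. *)
Lemma wdot_mulmxE u : - 2 * wdot u (Z *m u) =
  \sum_i \sum_j Z i j * w j 0 * (u i 0 / w i 0 - u j 0 / w j 0) ^+ 2.
Proof.
have -> : \sum_i \sum_j Z i j * w j 0 * (u i 0 / w i 0 - u j 0 / w j 0) ^+ 2 =
   \sum_i (\sum_j Z i j * w j 0) * (u i 0 / w i 0) ^+ 2
   + \sum_j (\sum_i Z i j) * (u j 0 ^+ 2 / w j 0)
   - 2 * \sum_i \sum_j u i 0 * (Z i j * u j 0) / w i 0.
  under [X in _ + X - _]eq_bigr do rewrite mulr_suml.
  rewrite [X in _ + X - _]exchange_big /=.
  rewrite mulr_sumr -sumrN -!big_split /=; apply: eq_bigr => i _.
  rewrite mulr_suml mulr_sumr -sumrN -!big_split /=; apply: eq_bigr => j _.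
  by field; rewrite !gt_eqF.
rewrite [X in _ = X + _ - _]big1 => [|i _]; last by rewrite Zrow mul0r.
rewrite [X in _ = _ + X - _]big1 => [|i _]; last by rewrite Zcol mul0r.
rewrite !add0r mulNr; congr (- (_ * _)); apply: eq_bigr => i _.
by rewrite mxE mulr_sumr mulr_suml.
Qed.

Let term_ge0 u i j : 0 <= Z i j * w j 0 * (u i 0 / w i 0 - u j 0 / w j 0) ^+ 2.
Proof.
have [->|nij] := eqVneq i j; first by rewrite subrr expr0n mulr0.
by rewrite mulr_ge0 ?sqr_ge0 // mulr_ge0 ?Zm ?w_ge0.
Qed.

Lemma wdot_mulmx_le0 u : wdot u (Z *m u) <= 0.
Proof.
have : 0 <= - 2 * wdot u (Z *m u).
  by rewrite wdot_mulmxE; apply: sumr_ge0 => i _; apply: sumr_ge0 => j _.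
lra.
Qed.

(** The cross term has a favourable sign by dissipativity. Read backwards, an implicit Euler step
    with [Z] never increases the form; the first stage and the remainder are bounded this way. *)
Lemma wsq_sub_mulmx_ge u c : 0 <= c -> wsq u <= wsq (u - c *: (Z *m u)).
Proof.
move=> c0; have -> : wsq (u - c *: (Z *m u)) =
    wsq u - 2 * c * wdot u (Z *m u) + c ^+ 2 * wsq (Z *m u).
  rewrite /wsq /wdot !mulr_sumr -sumrN -!big_split /=; apply: eq_bigr => i _.
  by rewrite !mxE; ring.
rewrite -addrA lerDl addr_ge0 //; last by rewrite mulr_ge0 ?sqr_ge0 ?wsq_ge0.
by rewrite -mulNr mulr_le0 ?wdot_mulmx_le0 // oppr_le0 mulr_ge0.
Qed.

(* [(Z u)_i] is a combination of the differences [u_j/w_j - u_i/w_i], so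
   Cauchy-Schwarz bounds it by the dissipation. *)
Lemma wsq_mulmx_le_dissipation :
  exists2 K, 0 < K & forall u, wsq (Z *m u) <= K * - wdot u (Z *m u).
Proof.
(* Only off-diagonal entries enter: diagonal ones may be negative, but they multiply a difference
   that is zero. *)
pose K := \sum_i \sum_(j | j != i) N%:R * (Z i j * w j 0) / w i 0.
have Kij i j : j != i -> 0 <= N%:R * (Z i j * w j 0) / w i 0.
  by move=> ji; rewrite divr_ge0 ?mulr_ge0 ?w_ge0 ?Zm 1?eq_sym ?w_ge0.
have K0 : 0 <= K by apply: sumr_ge0 => i _; apply: sumr_ge0 => j; exact: Kij.
exists (2 * K + 1) => [|u]; first by lra.
have D0 := wdot_mulmx_le0 u.
apply: (@le_trans _ _ (K * (- 2 * wdot u (Z *m u)))); last by nra.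
pose d i j := u i 0 / w i 0 - u j 0 / w j 0.
have Zu i : (Z *m u) i 0 = \sum_j Z i j * w j 0 * - d i j.
  rewrite mxE; under [RHS]eq_bigr do rewrite mulrN mulrBr opprB.
  rewrite sumrB -mulr_suml Zrow mul0r subr0; apply: eq_bigr => j _.
  by field; rewrite gt_eqF.
rewrite wdot_mulmxE wsqE.
set D := \sum_i \sum_j _.
have Dge i j : Z i j * w j 0 * d i j ^+ 2 <= D.
  rewrite /D (bigD1 i) //= (bigD1 j) //= -addrA lerDl.
  by apply: addr_ge0; rewrite ?sumr_ge0 // => k _; rewrite sumr_ge0.
rewrite /K mulr_suml; apply: ler_sum => i _.
rewrite ler_pdivrMr //= Zu; apply: le_trans (sqr_sum_le _) _.
rewrite (bigD1 i) //= /d subrr oppr0 mulr0 expr0n add0r -/(d _ _).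
rewrite mulr_sumr mulr_suml mulr_suml; apply: ler_sum => j ji.
rewrite -/(d i j) (_ : _ / _ * _ * _ = N%:R * (Z i j * w j 0) * D); last first.
  by field; rewrite gt_eqF.
rewrite -(mulrA N%:R) ler_wpM2l //; set c := Z i j * w j 0 in Dge *.
have c0 : 0 <= c by rewrite mulr_ge0 ?Zm 1?eq_sym ?w_ge0.
have -> : (c * - d i j) ^+ 2 = c * (c * d i j ^+ 2) by ring.
by rewrite ler_wpM2l // Dge.
Qed.

End Dissipative.
End WeightedForm.

(** * Ranges and kernels of square matrices *)

Lemma index1_factor (F : fieldType) (N : nat) (A : 'M[F]_N) :
  (forall u : 'cV[F]_N, A *m (A *m u) = 0 -> A *m u = 0) ->
  exists B : 'M[F]_N, A = B *m A *m A.
Proof.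
(* The columns of the cokernel of [A^2] are killed by [A^2], hence by [A], so the row space of [A]
   lies in that of [A^2]. The resulting [B] undoes [A] on its range. *)
move=> h; suff /submxP[B AB] : (A <= A *m A)%MS by exists B; rewrite -mulmxA.
rewrite submxE; apply/eqP/matrixP => i j.
have : A *m (A *m col j (cokermx (A *m A))) = 0.
  by rewrite colE 2!mulmxA mulmx_coker mul0mx.
move/h; rewrite colE mulmxA -colE => /matrixP/(_ i 0).
by rewrite !mxE.
Qed.

(** A Fredholm alternative, again tested on the columns of a cokernel. *)
Lemma range_of_annihilator (F : fieldType) (N : nat) (A : 'M[F]_N) (u : 'cV[F]_N) :
  (forall n : 'cV[F]_N, A^T *m n = 0 -> n^T *m u = 0) -> exists a, u = A *m a.
Proof.
move=> h; suff /submxP[a ua] : (u^T <= A^T)%MS.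
  by exists a^T; apply: trmx_inj; rewrite trmx_mul trmxK.
rewrite submxE; apply/eqP/matrixP => i j.
have /h : A^T *m col j (cokermx A^T) = 0 by rewrite colE mulmxA mulmx_coker mul0mx.
move=> /(congr1 trmx); rewrite trmx_mul trmxK trmx0 colE mulmxA -colE.
move=> /matrixP/(_ i 0).
by rewrite !mxE.
Qed.

(** * Strict contraction of the linearised scheme on the range of [Z] *)

Section Contraction.
Variables (R : realType) (N : nat) (w : 'cV[R]_N) (Z : 'M[R]_N) (gam sig : R).
Hypotheses (w_gt0 : pos_vec w) (Zm : metzler Z)
  (Zcol : forall j, \sum_i Z i j = 0) (Zw : Z *m w = 0).
Hypotheses (gam0 : 0 <= gam) (sig0 : 0 <= sig).
Implicit Types (u v : 'cV[R]_N).

(* Every consistent second-order stability function with denominator degree 2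
   is [rnum / rden] for suitable [gam] and [sig]. *)
Definition rnum v : 'cV[R]_N :=
  v - (gam - 1 / 2) *: (Z *m v) + ((sig - gam) / 2) *: (Z *m (Z *m v)).

Definition rden v : 'cV[R]_N :=
  v - (gam + 1 / 2) *: (Z *m v) + ((sig + gam) / 2) *: (Z *m (Z *m v)).

(** With [Z v] and [Z^2 v] as independent vectors this is a polynomial identity in each
    coordinate. *)
Lemma energy_identity v (f := v - gam *: (Z *m v)) :
  wsq w (rden v) - wsq w (rnum v) = gam * sig * wsq w (Z *m (Z *m v))
    - 2 * wdot w f (Z *m f) - sig * wdot w (Z *m v) (Z *m (Z *m v)).
Proof.
rewrite {}/f mulmxBr -scalemxAr /rden /rnum.
move: (Z *m v) => a; move: (Z *m a) => b.
rewrite /wsq /wdot !mulr_sumr -!sumrB; apply: eq_bigr => i _; rewrite !mxE.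
by field; rewrite gt_eqF ?w_gt0.
Qed.

(** As [rden v] lies in the range, so does [f], and [B] undoes [Z] there: [|rden v|^2 <= D |v|^2 <=
    D |f|^2 <= D C |Z f|^2 <= D C K (- <f, Z f>)]. The dissipation thus removes a fixed fraction of
    [|rden v|^2]. *)
Lemma rnum_contracts : (forall u, Z *m (Z *m u) = 0 -> Z *m u = 0) ->
  exists2 kap, 0 < kap < 1 & forall v a, rden v = Z *m a ->
    wsq w (rnum v) <= (1 - kap) * wsq w (rden v).
Proof.
move=> /index1_factor[B ZB].
have [K K0 hK] := wsq_mulmx_le_dissipation w_gt0 Zm Zcol Zw.
have [C C0 hC] := wsq_mulmx_le w_gt0 B.
pose Q : 'M[R]_N := 1%:M - (gam + 1 / 2) *: Z + ((sig + gam) / 2) *: (Z *m Z).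
have QE v : rden v = Q *m v.
  by rewrite /rden /Q !mulmxDl mulNmx mul1mx -!scalemxAl -mulmxA.
have [D D0 hD] := wsq_mulmx_le w_gt0 Q.
have L0 : 0 < D * C * K by rewrite !mulr_gt0.
exists (1 + D * C * K)^-1.
  by rewrite invr_gt0 invf_lt1 ?ltrDl ?addr_gt0 // L0.
move=> v a hv; set f := v - gam *: (Z *m v).
have [b fb] : exists b, f = Z *m b.
  (* [f - rden v] is [Z] applied to a combination of [v] and [Z v]. *)
  exists (a + (1 / 2) *: v - ((sig + gam) / 2) *: (Z *m v)).
  rewrite mulmxBr mulmxDr -!scalemxAr -hv /rden /f.
  by apply/matrixP => i j; rewrite !mxE; ring.
have vf : wsq w v <= wsq w f by apply: wsq_sub_mulmx_ge.
have ff : wsq w f <= C * wsq w (Z *m f).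
  by rewrite {1}fb {1}ZB -!mulmxA -fb.
have Qf : wsq w (rden v) <= D * C * K * - wdot w f (Z *m f).
  rewrite QE; apply: le_trans (hD v) _; rewrite -!mulrA ler_pM2l //.
  apply: le_trans vf _; apply: le_trans ff _; rewrite ler_pM2l //.
have := energy_identity v; rewrite -/f /= => E.
have g0 := mulr_ge0 (mulr_ge0 gam0 sig0) (wsq_ge0 w_gt0 (Z *m (Z *m v))).
have s0 := mulr_ge0_le0 sig0 (wdot_mulmx_le0 w_gt0 Zm Zcol Zw (Z *m v)).
have d0 := wdot_mulmx_le0 w_gt0 Zm Zcol Zw f.
have q0 := wsq_ge0 w_gt0 (rden v).
suff : (1 + D * C * K)^-1 * wsq w (rden v) <= - 2 * wdot w f (Z *m f).
  set kap := (1 + _)^-1 => hk; rewrite mulrBl mul1r; set x := kap * _ in hk *. lra.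
rewrite ler_pdivrMl; last by rewrite addr_gt0.
by nra.
Qed.

End Contraction.

(** * The second-stage weight as a function of one ratio *)

Section WeightFunction.
Variables (R : realType) (p c0 c1 : R).

(** Here [p] stands for the exponent [s] and [t] for the ratio [y1_i / y_i]. *)
Definition psi (t : R) : R := t `^ (- p) * (c0 + c1 * t).

Lemma psi1 : psi 1 = c0 + c1.
Proof. by rewrite /psi powR1 mul1r mulr1. Qed.

(** The exponents [- p] and [p - 1] add up to [-1], which cancels the degree of the linear
    factor. *)
Lemma psi_homogeneous (a b : R) : 0 < a -> 0 < b ->
  b `^ (- p) * (a `^ (p - 1) * (c0 * a + c1 * b)) = psi (b / a).
Proof.
move=> a0 b0; rewrite /psi.
have -> : b `^ (- p) = (b / a) `^ (- p) * a `^ (- p).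
  by rewrite -powRM ?divr_ge0 ?ltW // divfK ?gt_eqF.
have ainv : a `^ (- p) * a `^ (p - 1) = a^-1.
  rewrite -powRD; last by rewrite (gt_eqF a0) implybT.
  by rewrite (_ : - p + (p - 1) = -1) ?powR_inv1 ?ltW //; ring.
rewrite -mulrA (mulrA (a `^ (- p))) ainv; congr (_ * _).
by field; rewrite gt_eqF.
Qed.

(** The derivative of [psi] at [1]. *)
Definition dpsi : R := c1 - p * (c0 + c1).

Lemma psi_expansion eps : 0 < eps ->
  exists2 eta, 0 < eta & forall t, `|t - 1| < eta ->
    `|psi t - psi 1 - dpsi * (t - 1)| <= eps * `|t - 1|.
Proof.
move=> eps0.
have D : is_derive (1 : R) (1 : R) psi dpsi.
  have D1 : is_derive (1 : R) (1 : R) (@powR R ^~ (- p)) (- p * 1 `^ (- p - 1)).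
    exact: is_derive1_powR.
  have D2 : is_derive (1 : R) (1 : R) (cst c0 + c1 *: (@id R)) (0 + c1 *: (1 : R)).
    exact: is_deriveD.
  have := is_deriveM D1 D2.
  set val := (X in is_derive _ _ _ X).
  suff -> : val = dpsi by [].
  by rewrite /val /dpsi !powR1 !fctE /= /GRing.scale /=; ring.
have [D1 D2] := D.
have /cvgrPdist_le/(_ _ eps0) : h^-1 *: ((psi \o shift (1 : R)) (h *: (1 : R)) - psi 1)
    @[h --> (0 : R)^'] --> dpsi by rewrite -D2; exact: D1.
case=> e /= e0 he; exists e => // t te.
have [->|t1] := eqVneq t 1; first by rewrite !subrr mulr0 subr0 normr0 mulr0.
have := he (t - 1); rewrite /= sub0r normrN te subr_eq0 => /(_ isT t1).
rewrite /GRing.scale /= mulr1 subrK => hd.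
have t10 : `|t - 1| != 0 by rewrite normr_eq0 subr_eq0.
rewrite -ler_pdivrMr ?lt_def ?t10 ?normr_ge0 // -normfV -normrM.
apply: le_trans hd; rewrite le_eqVlt; apply/orP; left; apply/eqP; rewrite -normrN; congr `|_|.
by field; rewrite subr_eq0.
Qed.

(* [t - 1 = (m - h) / (w + h)] with [w + h >= w / 2]. *)
Lemma psi_relative_expansion eps : 0 < eps ->
  exists2 th, 0 < th & forall w h m, 0 < w -> `|h| <= th * w -> `|m| <= th * w ->
    let t := (w + m) / (w + h) in
    `|w * (psi t - psi 1) - dpsi * (m - h)| <= eps * `|m - h| /\
    `|psi t - psi 1| <= eps.
Proof.
move=> eps0; set L := `|dpsi|; have L0 : 0 <= L by exact: normr_ge0.
(* The first claim needs [2 * e * (1 + L) <= eps], the second [4 * e * (1 + L) <= eps]. *)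
pose e := Num.min 1 (eps / (4 * (1 + L))).
have e0 : 0 < e by rewrite lt_min ltr01 divr_gt0 // mulr_gt0 // ltr_pwDl.
have e1 : e <= 1 by rewrite ge_min lexx.
have eL : e * (4 * (1 + L)) <= eps.
  by rewrite -ler_pdivlMr ?ge_min ?lexx ?orbT // mulr_gt0 // ltr_pwDl.
clearbody e.
have [eta eta0 heta] := psi_expansion e0.
(* The three bounds give, in turn, [w + h >= w / 2], [|h| <= e * w], and [|t - 1| < eta] through
   [|t - 1| <= 4 * th]. *)
pose th := Num.min (1 / 2) (Num.min e (eta / 8)).
have th0 : 0 < th by rewrite !lt_min e0 !divr_gt0.
have [th2 the theta] : [/\ th <= 1 / 2, th <= e & th <= eta / 8].
  by rewrite /th !ge_min !lexx !orbT.
exists th => // w h m w0 hh mm t.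
have wh2 : w / 2 <= w + h by move: hh; rewrite ler_norml => /andP[]; nra.
have wh0 : 0 < w + h by apply: lt_le_trans wh2; rewrite divr_gt0.
have tE : (w + h) * (t - 1) = m - h by rewrite /t; field; rewrite gt_eqF.
set T := `|t - 1|; have T0 : 0 <= T by exact: normr_ge0.
have wT : w * T <= 2 * `|m - h|.
  by rewrite -tE normrM -/T (gtr0_norm wh0); nra.
have mh : `|m - h| <= 2 * th * w by apply: le_trans (ler_normB _ _) _; lra.
have T4 : T <= 4 * th by rewrite -(ler_pM2l w0); lra.
have lin := heta t; rewrite -/T in lin.
have {}lin : `|psi t - psi 1 - dpsi * (t - 1)| <= e * T by apply: lin; lra.
split.
  (* Since [m - h] is [(w + h) * (t - 1)] and not [w * (t - 1)], the second-order term
     [dpsi * h * (t - 1)] appears. *)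
  have -> : w * (psi t - psi 1) - dpsi * (m - h) =
      w * (psi t - psi 1 - dpsi * (t - 1)) - dpsi * h * (t - 1).
    by rewrite -tE; ring.
  apply: le_trans (ler_normB _ _) _; rewrite !normrM -/T -/L (gtr0_norm w0).
  have A1 : w * `|psi t - psi 1 - dpsi * (t - 1)| <= e * (w * T).
    by rewrite mulrCA ler_pM2l.
  have A2 : L * `|h| * T <= L * e * (w * T).
    rewrite [leRHS](_ : _ = L * (e * w) * T); last by ring.
    rewrite ler_wpM2r // ler_wpM2l //; apply: le_trans hh _.
    by rewrite ler_pM2r.
  apply: le_trans (lerD A1 A2) _; rewrite -mulrDl.
  apply: (@le_trans _ _ ((e + L * e) * (2 * `|m - h|))).
    by rewrite ler_wpM2l // addr_ge0 ?mulr_ge0 // ltW.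
  have := normr_ge0 (m - h); nra.
have -> : psi t - psi 1 = (psi t - psi 1 - dpsi * (t - 1)) + dpsi * (t - 1) by ring.
apply: le_trans (ler_normD _ _) _; rewrite normrM -/T -/L.
have LT : L * T <= L * (4 * e) by rewrite ler_wpM2l //; lra.
have eT : e * T <= 4 * e by nra.
nra.
Qed.

End WeightFunction.

(** * Local contraction of the nonlinear scheme *)

Section LocalContraction.
Variables (R : realType) (N : nat) (A : 'M[R]_N) (alpha beta dt : R) (w : 'cV[R]_N).
Hypotheses (Am : metzler A) (A1 : A^T *m const_mx 1 = 0 :> 'cV[R]_N).
Hypotheses (halpha : 0 <= alpha <= 1) (beta0 : 0 < beta)
  (hab : alpha * beta + 1 / (2 * beta) <= 1) (halpha' : alpha <= 1 / (2 * beta)).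
Hypotheses (dt0 : 0 < dt) (w_gt0 : pos_vec w) (Aw : A *m w = 0).
Hypothesis A_index1 : forall u : 'cV[R]_N, A *m (A *m u) = 0 -> A *m u = 0.

Let Z := dt *: A.
Let gam := 1 / 2 + (1 - alpha) * beta.
Let sig := (2 * beta - 1) * (1 - 2 * alpha * beta) / 2.
Let d0 := 1 - alpha * beta.
Let s := sspmprk_s alpha beta.
Let c20 := beta20 alpha beta.
Let c21 := beta21 beta.

Let Zm : metzler Z.
Proof. by move=> i j ij; rewrite mxE mulr_ge0 ?Am // ltW. Qed.

Let Zcol j : \sum_i Z i j = 0.
Proof. by under eq_bigr do rewrite mxE; rewrite -mulr_sumr colsum0 ?mulr0. Qed.

Let Zw : Z *m w = 0. Proof. by rewrite -scalemxAl Aw scaler0. Qed.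

Let Z_index1 (u : 'cV[R]_N) : Z *m (Z *m u) = 0 -> Z *m u = 0.
Proof.
rewrite -!scalemxAl -scalemxAr scalerA => /eqP.
rewrite scaler_eq0 mulf_eq0 gt_eqF //= => /eqP/A_index1 ->; exact: scaler0.
Qed.

(** [hab] multiplied by [beta]; it gives [beta >= 1 / 2] and [d0 > 0]. *)
Let hb1 : 1 / 2 <= beta * (1 - alpha * beta).
Proof.
have : beta * (alpha * beta + 1 / (2 * beta)) <= beta * 1 by rewrite ler_pM2l.
rewrite mulrDr mulr1.
by rewrite (_ : beta * (1 / (2 * beta)) = 1 / 2); [nra | field; rewrite gt_eqF].
Qed.

Let beta_ge : 1 / 2 <= beta.
Proof. by case/andP: halpha => a0 _; have := hb1; have := mulr_ge0 a0 (sqr_ge0 beta); lra. Qed.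

(** [halpha'] multiplied by [2 * beta]; with [beta >= 1 / 2] it makes [sig] nonnegative. *)
Let hb2 : 2 * alpha * beta <= 1.
Proof.
have : 2 * beta * alpha <= 2 * beta * (1 / (2 * beta)).
  by rewrite ler_pM2l // mulr_gt0.
by rewrite (_ : 2 * beta * (1 / (2 * beta)) = 1); [nra | field; rewrite gt_eqF].
Qed.

Let gam0 : 0 <= gam.
Proof.
by case/andP: halpha => _ a1; rewrite addr_ge0 // mulr_ge0 ?subr_ge0 // ltW.
Qed.

Let sig0 : 0 <= sig.
Proof. by rewrite /sig divr_ge0 // mulr_ge0 //; have := beta_ge; have := hb2; lra. Qed.

Let d0_gt0 : 0 < d0.
Proof. by rewrite -(pmulr_rgt0 _ beta0); apply: lt_le_trans hb1; rewrite divr_gt0. Qed.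

Let psi_at1 : psi s c20 c21 1 = d0.
Proof. by rewrite psi1 /c20 /c21 /d0 /beta20 /beta21; ring. Qed.

(** The formula for [s] makes the slope of the weights match the [Z^2] coefficient of [rnum]. *)
Let dpsiE : beta * dpsi s c20 c21 = (sig - gam) / 2.
Proof.
rewrite /dpsi /sig /gam /s /sspmprk_s /c20 /c21 /beta20 /beta21.
by field; rewrite !gt_eqF //; move: d0_gt0; rewrite /d0 mulrC.
Qed.

Lemma sspmprk2_relE y x : pos_vec y -> sspmprk2_rel A alpha beta dt y x ->
  exists y1, [/\ pos_vec y1, y1 = y + beta *: (Z *m y1) &
    x = (1 - alpha) *: y + alpha *: y1 +
        Z *m (\col_i (x i 0 * psi s c20 c21 (y1 i 0 / y i 0)))].
Proof.
move=> y0 [y1 [y10 x0 e1 e2]]; exists y1; split=> //.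
  by rewrite {1}e1 -scalemxAl scalerA.
rewrite {1}e2 -scalemxAl; congr (_ + _ *: _); rewrite -!mulmxA; congr (_ *m _).
apply/matrixP => i j; rewrite [j]ord1 /diagv /diag_pow !mul_diag_mx !mxE.
by rewrite psi_homogeneous.
Qed.

(** With [h], [m], [k] the deviations of [y], [y1], [x] from [w], one has [h = rden v] and
    [k = rnum v + r]. The first part contracts, and the expansion of [psi] makes [r] small relative
    to [h] and [k]. *)
Lemma sspmprk2_local_contraction : exists2 rho, 0 <= rho < 1 &
  exists2 del, 0 < del & forall y x, pos_vec y ->
    (exists a, y - w = Z *m a) -> wsq w (y - w) <= del ->
    sspmprk2_rel A alpha beta dt y x ->
    (exists a, x - w = Z *m a) /\ wsq w (x - w) <= rho * wsq w (y - w).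
Proof.
have [kap /andP[kap0 kap1] hkap] :=
  rnum_contracts w_gt0 Zm Zcol Zw gam0 sig0 Z_index1.
have [C C0 hC] := wsq_mulmx_le w_gt0 Z.
(* [5 * xi = kap^2 / 2] is what the last inequality needs to reach the factor [1 - kap^2 / 2]. *)
pose xi := kap ^+ 2 / 10; have xi0 : 0 < xi by rewrite divr_gt0 ?exprn_gt0.
(* The factors come from Young's inequality, from applying [Z], and from splitting [e1 + e2]. *)
pose D := (1 + kap^-1) * C * 2.
have D0 : 0 < D by rewrite !mulr_gt0 // ltr_pwDl // invr_ge0 ltW.
pose eps := Num.min 1 (xi / D).
have eps0 : 0 < eps by rewrite lt_min ltr01 divr_gt0.
have Deps : D * eps ^+ 2 <= xi.
  rewrite mulrC -ler_pdivlMr //; apply: (@le_trans _ _ eps).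
    by rewrite expr2 ger_pMr // ge_min lexx.
  by rewrite ge_min lexx orbT.
clearbody eps.
have [th th0 hth] := psi_relative_expansion s c20 c21 eps0.
pose S := \sum_i (w i 0)^-1.
have S0 : 0 <= S by apply: sumr_ge0 => i _; rewrite invr_ge0 ltW.
exists (1 - kap ^+ 2 / 2); first by apply/andP; split; nra.
(* Since [1 + S >= 1 / w_i], this bound on the form forces [|u_i| <= th * w_i] in each
   coordinate. *)
exists (th ^+ 2 / (1 + S)); first by rewrite divr_gt0 ?exprn_gt0 ?ltr_pwDl.
move=> y x y0 [a ya] hy /(sspmprk2_relE y0)[y1 [y10 ey1 ex]].
set h := y - w in ya hy *; set k := x - w; pose m := y1 - w.
set X := \col_i _ in ex.
have mE : m = h + beta *: (Z *m m).
  by rewrite /m mulmxBr Zw subr0 {1}ey1 addrAC.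
have kE : k = (1 - alpha) *: h + alpha *: m + Z *m X.
  rewrite /k {1}ex /h /m; apply/matrixP => i j; rewrite !mxE; ring.
split.
  exists (a + (alpha * beta) *: m + X).
  rewrite !mulmxDr -scalemxAr -ya kE {1}mE.
  by apply/matrixP => i j; rewrite !mxE; ring.
have wm : wsq w m <= wsq w h.
  have -> : h = m - beta *: (Z *m m) by rewrite {1}mE addrK.
  by apply: wsq_sub_mulmx_ge => //; exact: ltW.
have small u : wsq w u <= wsq w h -> forall i, `|u i 0| <= th * w i 0.
  move=> uh i; rewrite -ler_sqr ?nnegrE //; last by rewrite mulr_ge0 // ltW.
  rewrite real_normK ?num_real //; apply: le_trans (sqr_coord_le_wsq w_gt0 u i) _.
  rewrite exprMn expr2 [leRHS](_ : _ = w i 0 * (th ^+ 2 * w i 0)); last by ring.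
  rewrite ler_pM2l //; apply: le_trans uh _; apply: le_trans hy _.
  rewrite ler_pM2l ?exprn_gt0 // -[leRHS]invrK lef_pV2 ?posrE ?ltr_pwDl ?invr_gt0 //.
  rewrite /S (bigD1 i) //= addrCA lerDl addr_ge0 // sumr_ge0 // => j _.
  by rewrite invr_ge0 ltW.
(* Expanding [x_i psi = (w_i + k_i) (d0 + e_i)] leaves two errors: the product [k_i e_i] and the
   Taylor remainder of [w_i e_i]. *)
pose e i := psi s c20 c21 (y1 i 0 / y i 0) - d0.
pose e1 : 'cV[R]_N := \col_i (k i 0 * e i).
pose e2 : 'cV[R]_N := \col_i (w i 0 * e i - dpsi s c20 c21 * (m - h) i 0).
have hexp i : `|w i 0 * e i - dpsi s c20 c21 * (m - h) i 0| <= eps * `|(m - h) i 0|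
    /\ `|e i| <= eps.
  have := hth (w i 0) (h i 0) (m i 0) (w_gt0 i) (small _ (lexx _) i) (small _ wm i).
  rewrite /= psi_at1 /e (_ : w i 0 + m i 0 = y1 i 0); last by rewrite /m !mxE; ring.
  rewrite (_ : w i 0 + h i 0 = y i 0); last by rewrite /h !mxE; ring.
  by rewrite (_ : (m - h) i 0 = m i 0 - h i 0) // !mxE.
have XE : Z *m X = d0 *: (Z *m k) + dpsi s c20 c21 *: (Z *m (m - h)) + Z *m (e1 + e2).
  have -> : X = d0 *: w + d0 *: k + dpsi s c20 c21 *: (m - h) + (e1 + e2).
    by apply/matrixP => i j; rewrite [j]ord1 /k /h /m !mxE; rewrite /e; ring.
  move: (k) (m - h) (e1 + e2) => k' d e12.
  by rewrite !mulmxDr -!scalemxAr Zw scaler0 add0r.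
have [d0m d0c] : metzler (d0 *: Z) /\ forall j, \sum_i (d0 *: Z) i j = 0.
  split=> [i j ij|j]; first by rewrite mxE mulr_ge0 ?Zm // ltW.
  by under eq_bigr do rewrite mxE; rewrite -mulr_sumr Zcol mulr0.
(* With [m = (1 - d0 Z) v], the first stage reads [h = (1 - beta Z) (1 - d0 Z) v], the factored form
   of [rden v]. *)
have [v [vE _]] := metzler_sol_exists m d0m d0c.
rewrite -scalemxAl in vE.
have {}vE : m = v - d0 *: (Z *m v) by rewrite {1}vE addrK.
have hE : h = rden Z gam sig v.
  have -> : h = m - beta *: (Z *m m) by rewrite {1}mE addrK.
  rewrite vE mulmxBr -scalemxAr /rden /gam /sig /d0.
  by apply/matrixP => i j; rewrite !mxE; field.
pose r := k - rnum Z gam sig v.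
(* Up to the errors, [k] and [rnum v] solve the same implicit equation, with right side [rnum m]. *)
have rE : r - d0 *: (Z *m r) = Z *m (e1 + e2).
  have -> : Z *m (e1 + e2) = k - d0 *: (Z *m k)
      - ((1 - alpha) *: h + alpha *: m + dpsi s c20 c21 *: (Z *m (m - h))).
    by rewrite {1}kE XE; apply/matrixP => i j; rewrite !mxE; ring.
  have -> : (1 - alpha) *: h + alpha *: m + dpsi s c20 c21 *: (Z *m (m - h)) =
      rnum Z gam sig m.
    have mh : m - h = beta *: (Z *m m) by rewrite {1}mE addrAC subrr add0r.
    have hm : h = m - beta *: (Z *m m) by rewrite -mh opprB addrC subrK.
    rewrite /rnum -dpsiE mh -scalemxAr hm /gam.
    move: (m) (Z *m m) (Z *m (Z *m m)) => a0 a1 a2.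
    by apply/matrixP => i j; rewrite !mxE; field.
  have -> : rnum Z gam sig m = rnum Z gam sig v - d0 *: (Z *m rnum Z gam sig v).
    rewrite /rnum {1 2 3}vE !(mulmxBr, mulmxDr) -!scalemxAr.
    by apply/matrixP => i j; rewrite !mxE; ring.
  by rewrite /r mulmxBr; apply/matrixP => i j; rewrite !mxE; ring.
have wr : wsq w r <= C * wsq w (e1 + e2).
  apply: le_trans (hC _); rewrite -rE.
  by apply: wsq_sub_mulmx_ge => //; exact: ltW.
have we1 : wsq w e1 <= eps ^+ 2 * wsq w k.
  apply: wsq_le => // i; rewrite mxE exprMn mulrC ler_wpM2r ?sqr_ge0 //.
  by rewrite -(real_normK (num_real (e i))) ler_sqr ?nnegrE ?(ltW eps0) //; case: (hexp i).
have we2 : wsq w e2 <= eps ^+ 2 * wsq w (m - h).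
  apply: wsq_le => // i; rewrite [e2 i 0]mxE -exprMn.
  rewrite -[leLHS](real_normK (num_real _)) -[leRHS](real_normK (num_real _)).
  rewrite ler_sqr ?nnegrE // [`|eps * _|]normrM (gtr0_norm eps0).
  by case: (hexp i).
have wmh : wsq w (m - h) <= 4 * wsq w h.
  by have := wsqD_le2 w_gt0 m (- h); rewrite wsqN; lra.
have we := wsqD_le2 w_gt0 e1 e2.
have kr : k = rnum Z gam sig v + r by rewrite /r addrC subrK.
have wk := wsqD_le w_gt0 (rnum Z gam sig v) r kap0; rewrite -kr in wk.
have wv := hkap v a; rewrite -hE in wv; have {}wv := wv ya.
move: wk wv wr we we1 we2 wmh (wsq_ge0 w_gt0 k) (wsq_ge0 w_gt0 h).
move: (wsq w k) (wsq w h) (wsq w r) (wsq w (rnum _ _ _ _)) => K H Rr P.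
move: (wsq w (e1 + e2)) (wsq w e1) (wsq w e2) (wsq w (m - h)) => E12 E1 E2 M.
move=> wk wv wr we we1 we2 wmh K0 H0.
have bE12 : E12 <= eps ^+ 2 * (2 * (K + 4 * H)).
  have := ler_wpM2l (sqr_ge0 eps) wmh; lra.
have bR : (1 + kap^-1) * Rr <= xi * (K + 4 * H).
  apply: (@le_trans _ _ (D * eps ^+ 2 * (K + 4 * H))); last first.
    by rewrite ler_wpM2r // addr_ge0 ?mulr_ge0.
  rewrite /D -!mulrA ler_pM2l; last by rewrite addr_gt0 ?invr_gt0.
  apply: le_trans wr _; rewrite ler_pM2l //.
  by apply: le_trans bE12 _; rewrite mulrCA expr2 -!mulrA.
have bP : (1 + kap) * P <= (1 - kap ^+ 2) * H.
  apply: (@le_trans _ _ ((1 + kap) * ((1 - kap) * H))); last by lra.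
  by rewrite ler_pM2l // ltr_pwDl // ltW.
(* The error [e1] brings [K] to the right-hand side; as [xi < 1] it is absorbed on the left. *)
have main : (1 - xi) * K <= (1 - kap ^+ 2 + 4 * xi) * H.
  by have := le_trans wk (lerD bP bR); lra.
have xi1 : xi < 1 by rewrite /xi; nra.
rewrite -(ler_pM2l (_ : 0 < 1 - xi)) ?subr_gt0 //; apply: le_trans main _.
rewrite [leRHS]mulrA ler_wpM2r // /xi; nra.
Qed.

End LocalContraction.

(** * From the contraction to convergence of the iterates *)

Lemma same_invariants_range (R : realType) (N : nat) (A : 'M[R]_N) (y z : 'cV[R]_N) :
  same_invariants A y z -> exists a, y - z = A *m a.
Proof.
move=> h; apply: range_of_annihilator => n /h.
by rewrite mulmxBr => ->; rewrite subrr.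
Qed.

(** If [A (A u) = 0], adding [A u] to [ystar] stays in the kernel and changes no invariant, so
    uniqueness forces [A u = 0]. *)
Lemma steady_state_index1 (R : realType) (N : nat) (A : 'M[R]_N)
    (y0 ystar : 'cV[R]_N) : steady_state A y0 ystar ->
  forall u : 'cV[R]_N, A *m (A *m u) = 0 -> A *m u = 0.
Proof.
case=> -[Ay inv] uniq u AAu.
suff /uniq : A *m (ystar + A *m u) = 0 /\ same_invariants A (ystar + A *m u) y0.
  by move/eqP; rewrite -subr_eq0 opprD addNKr oppr_eq0 => /eqP.
split; first by rewrite mulmxDr Ay AAu addr0.
move=> n An; rewrite mulmxDr inv // mulmxA.
by rewrite -[n^T *m A]trmxK trmx_mul trmxK An trmx0 mul0mx addr0.
Qed.

Lemma mx_norm_ltP (R : realType) (N : nat) (u : 'cV[R]_N) (e : R) : 0 < e ->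
  `|u| < e <-> forall i, `|u i 0| < e.
Proof.
have -> : `|u| = \big[Num.max/0]_ij `|u ij.1 ij.2|.
  by rewrite [LHS]/Num.norm /= mx_normrE.
move=> e0; split=> [/bigmax_ltP[_ h] i|h].
  exact: (h (i, 0)).
by apply/bigmax_ltP; split=> // -[i j] _; rewrite /= ord1.
Qed.

Theorem corollary3p4 (R : realType) (N : nat) (A : 'M[R]_N) (alpha beta : R)
    (y0 ystar : 'cV[R]_N)
    (hA : metzler A)
    (hA1 : A^T *m const_mx 1 = 0 :> 'cV[R]_N)
    (halpha : 0 <= alpha <= 1)
    (hbeta : 0 < beta)
    (hab : alpha * beta + 1 / (2 * beta) <= 1)
    (hy0 : pos_vec y0)
    (hystar : steady_state A y0 ystar)
    (hystar_pos : pos_vec ystar)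
    (hcond :
      (alpha < 1 / (2 * beta) /\ (alpha, beta) <> (0, 1 / 2)) \/
      ((alpha = 1 / (2 * beta) \/ (alpha, beta) = (0, 1 / 2)) /\
       nonzero_eigenvalues_neg A)) :
  forall dt : R, 0 < dt ->
  exists2 delta : R, 0 < delta &
    forall z : 'cV[R]_N,
      pos_vec z -> same_invariants A z ystar -> `|z - ystar| < delta ->
      iter n (sspmprk2 A alpha beta dt) z @[n --> \oo] --> ystar.
Proof.
move=> dt dt0; have Aw : A *m ystar = 0 by case: hystar => -[].
(* Both cases of [hcond] give this bound, so they are treated together. *)
have halpha' : alpha <= 1 / (2 * beta).
  case: hcond => [[/ltW //]|[[->|[-> _]] _]] //.
  by rewrite divr_ge0 // mulr_ge0 // ltW.
have [rho /andP[rho0 rho1] [del del0 step]] :=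
  sspmprk2_local_contraction hA hA1 halpha hbeta hab halpha' dt0 hystar_pos Aw
    (steady_state_index1 hystar).
pose S := \sum_i (ystar i 0)^-1.
have S0 : 0 <= S by apply: sumr_ge0 => i _; rewrite invr_ge0 ltW.
(* The max norm bound gives [wsq <= delta^2 * S], and [delta <= 1] reduces this to
   [delta * (1 + S) <= del]. *)
pose delta := Num.min 1 (del / (1 + S)).
have delta0 : 0 < delta by rewrite lt_min ltr01 divr_gt0 // ltr_pwDl.
exists delta => // z z0 zinv zd.
have q0 : wsq ystar (z - ystar) <= del.
  apply: (@le_trans _ _ (delta ^+ 2 * S)).
    rewrite wsqE mulr_sumr; apply: ler_sum => i _; rewrite ler_pM2r ?invr_gt0 //.
    rewrite -(real_normK (num_real _)) ler_sqr ?nnegrE ?(ltW delta0) //.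
    by apply/ltW; move: i; apply/mx_norm_ltP.
  apply: (@le_trans _ _ (delta * (1 + S))); last first.
    by rewrite -ler_pdivlMr ?ltr_pwDl // ge_min lexx orbT.
  have delta1 : delta <= 1 by rewrite ge_min lexx.
  by apply: ler_pM; rewrite ?sqr_ge0 ?lerDr // expr2 ger_pMr.
pose y n := iter n (sspmprk2 A alpha beta dt) z.
(* Positivity and range membership are carried along because the next contraction step requires
   them. *)
have iterP n : [/\ pos_vec (y n), exists a, y n - ystar = (dt *: A) *m a &
    wsq ystar (y n - ystar) <= wsq ystar (z - ystar) * rho ^+ n].
  elim: n => [|n [yn0 yna ynq]].
    split=> //=; last by rewrite mulr1.
    have [a ->] := same_invariants_range zinv; exists (dt^-1 *: a).
    by rewrite -scalemxAl -scalemxAr scalerA mulfV ?gt_eqF // scale1r.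
  have [_ [_ rel]] := sspmprk2_relP hA hA1 halpha hbeta hab dt0 yn0.
  have ynd : wsq ystar (y n - ystar) <= del.
    apply: le_trans ynq (le_trans _ q0).
    by rewrite ler_piMr ?wsq_ge0 // exprn_ile1 // ltW.
  have [range contr] := step _ _ yn0 yna ynd rel.
  split; [by case: rel => y1 [] | exact: range |].
  apply: le_trans contr _; rewrite exprS mulrCA; exact: ler_wpM2l.
(* [W] dominates every weight, so the geometric decay of the form bounds all coordinates at once. *)
pose W := 1 + \sum_i ystar i 0.
have W0 : 0 < W by rewrite ltr_pwDl // sumr_ge0 // => i _; exact: ltW.
have lim : W * wsq ystar (z - ystar) * rho ^+ n @[n --> \oo] --> (0 : R).
  by apply: cvg_geometric; rewrite ger0_norm.
apply/cvgrPdist_lt => e e0; have e20 : 0 < e ^+ 2 by rewrite exprn_gt0.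
near=> n; rewrite distrC; apply/mx_norm_ltP => // i.
have [_ _ yq] := iterP n.
rewrite -ltr_sqr ?nnegrE ?(ltW e0) // real_normK ?num_real //.
apply: le_lt_trans (sqr_coord_le_wsq hystar_pos _ i) _.
apply: (@le_lt_trans _ _ (W * wsq ystar (z - ystar) * rho ^+ n)).
  rewrite -mulrA; apply: ler_pM => //; [exact: ltW | exact: wsq_ge0 |].
  rewrite /W (bigD1 i) //= addrCA lerDl addr_ge0 // sumr_ge0 // => j _.
  exact: ltW.
apply: le_lt_trans (ler_norm _) _; rewrite -[X in `|X|]subr0.
by near: n; apply: cvgr_distC_lt.
Unshelve. all: by end_near.
Qed.
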